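(* Let $p$ be a prime and let $G$ be a Puchta group with respect to $p$, i.e. a group having a presentation $\langle X|R\rangle$ with $X$ finite and $R$ finite or infinite such that $\mathrm{def}_p(G;X,R)>1$. Then $G$ has a subgroup of finite index which is Golod-Shafarevich (with respect to $p$), and this subgroup can be taken to be normal in $G$ and of index a power of $p$ in $G$.
   Context: For a presentation $\langle X|R\rangle$ of $G$ with $X$ finite and $R$ a subset (finite or infinite) of the free group $F(X)$, the $p$-deficiency is $\mathrm{def}_p(G;X,R)=|X|-\sum_{r\in R}p^{-\nu_p(r)}$, where $\nu_p(r)=\max\{k\ge 0 : \exists w\in F(X),\ w^{p^k}=r\}$; if $R$ is infinite and the sum does not converge, then $\mathrm{def}_p(G;X,R)=-\infty$. The Zassenhaus $p$-filtration $\{G_n\}$ of a group $G$ is given by $G_1=G$ and $G_i=[G_{i-1},G]\,G_{\lceil i/p\rceil}^p$ for $i\ge 2$. For a non-identity $w\in F(X)$, the degree $\deg(w)$ (with respect to $p$) is the maximum $i$ such that $w\in F(X)_i$. A presentation $\langle X|R\rangle$ with $X$ finite and $R=\{r_1,r_2,\ldots\}$ finite or infinite satisfies the Golod-Shafarevich condition with respect to $p$ if there exists a real number $t\in(0,1)$ such that $1-|X|t+\sum_{i}t^{\deg(r_i)}<0$. A group is Golod-Shafarevich (with respect to $p$) if it has a presentation satisfying this condition. *)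

(* Defs.v *)
From HB Require Import structures.
From mathcomp Require Import all_boot all_order all_algebra.
From mathcomp Require Import boolp classical_sets functions cardinality.
From mathcomp Require Import reals ereal esum.
From mathcomp Require Import zify.

Set Implicit Arguments.
Unset Strict Implicit.
Unset Printing Implicit Defensive.

Import Order.TTheory GRing.Theory Num.Theory.
Local Open Scope classical_set_scope.
Local Open Scope card_scope.
Local Open Scope group_scope.

(* The letter (x, false) stands for the generator x and (x, true) for its     *)
(* inverse; elements of the free group are the reduced words, and u * v is    *)
(* computed by pushing the letters of u onto v, from right to left.           *)
Section FreeGroup.
Variable X : choiceType.
Implicit Types (a b : X * bool) (u v w : seq (X * bool)).

Definition letter_inv a : X * bool := (a.1, ~~ a.2).

Definition reduced w : bool := sorted (fun a b => b != letter_inv a) w.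

Definition push a w : seq (X * bool) :=
  if w is b :: w' then (if b == letter_inv a then w' else a :: w) else [:: a].

Definition word_mul u v : seq (X * bool) := foldr push v u.

Definition word_inv w : seq (X * bool) := rev (map letter_inv w).

Lemma letter_invK : involutive letter_inv.
Proof. by case=> x b; rewrite /letter_inv /= negbK. Qed.

Lemma letter_inv_inj : injective letter_inv.
Proof. exact: can_inj letter_invK. Qed.

Lemma reduced_behead a w : reduced (a :: w) -> reduced w.
Proof. by case: w => //= b w /andP[]. Qed.

Lemma reduced_push a w : reduced w -> reduced (push a w).
Proof.
case: w => //= b w rw; case: eqP => [_|/eqP nb]; last by rewrite /= nb.
exact: reduced_behead rw.
Qed.

Lemma reduced_mul u v : reduced v -> reduced (word_mul u v).
Proof. by move=> rv; elim: u => //= a u; apply: reduced_push. Qed.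

Lemma reduced_inv w : reduced w -> reduced (word_inv w).
Proof.
rewrite /reduced /word_inv rev_sorted sorted_map; apply: sub_sorted => a b /=.
by apply: contra => /eqP ->; rewrite !letter_invK.
Qed.

Lemma pushK a w : reduced w -> push a (push (letter_inv a) w) = w.
Proof.
case: w => [|b w] rw /=; first by rewrite eqxx.
rewrite letter_invK; case: eqP => [<-|_] /=; last by rewrite eqxx.
by case: w rw => //= c w /andP[/negPf ->].
Qed.

Lemma push_mul a u v :
  reduced v -> word_mul (push a u) v = push a (word_mul u v).
Proof.
case: u => //= b u rv; case: eqP => //= ->.
by rewrite pushK //; apply: reduced_mul.
Qed.

Lemma word_mulA u v w :
  reduced w -> word_mul u (word_mul v w) = word_mul (word_mul u v) w.
Proof. by move=> rw; elim: u => //= a u ->; rewrite push_mul. Qed.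

Lemma word_mulr0 w : reduced w -> word_mul w [::] = w.
Proof.
elim: w => //= a w IHw rw; rewrite IHw ?(reduced_behead rw) //.
by case: w rw {IHw} => //= b w /andP[/negPf ->].
Qed.

Lemma word_invK : involutive word_inv.
Proof.
by move=> w; rewrite /word_inv map_rev revK -map_comp map_id_in // => a _ /=;
   rewrite letter_invK.
Qed.

Lemma word_mulV w : word_mul (word_inv w) w = [::].
Proof.
elim: w => // a w IHw.
by rewrite /word_inv map_cons rev_cons /word_mul foldr_rcons /= letter_invK eqxx.
Qed.

Record free_group : Type :=
  FreeGroup { free_word : seq (X * bool); free_wordP : reduced free_word }.

HB.instance Definition _ := [isSub for free_word].
HB.instance Definition _ := [Choice of free_group by <:].

Implicit Types (f g h : free_group).

Definition free_mul f g : free_group :=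
  FreeGroup (reduced_mul (free_word f) (free_wordP g)).
Definition free_one : free_group := @FreeGroup [::] isT.
Definition free_inv f : free_group := FreeGroup (reduced_inv (free_wordP f)).
Definition free_gen (x : X) : free_group := @FreeGroup [:: (x, false)] isT.

Fact free_mulA : associative free_mul.
Proof. by move=> f g h; apply: val_inj; apply: word_mulA (free_wordP h). Qed.
Fact free_mul1g : left_id free_one free_mul.
Proof. by move=> f; apply: val_inj. Qed.
Fact free_mulg1 : right_id free_one free_mul.
Proof. by move=> f; apply: val_inj; apply: word_mulr0 (free_wordP f). Qed.
Fact free_mulVg : left_inverse free_one free_inv free_mul.
Proof. by move=> f; apply: val_inj; apply: word_mulV. Qed.
Fact free_mulgV : right_inverse free_one free_inv free_mul.
Proof.
move=> f; apply: val_inj; rewrite /= -{1}[free_word f]word_invK.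
exact: word_mulV.
Qed.

HB.instance Definition _ := hasMul.Build free_group free_mul.
HB.instance Definition _ := Magma_isSemigroup.Build free_group free_mulA.
HB.instance Definition _ := hasOne.Build free_group free_one.
HB.instance Definition _ :=
  BaseUMagma_isUMagma.Build free_group free_mul1g free_mulg1.
HB.instance Definition _ := hasInv.Build free_group free_inv.
HB.instance Definition _ :=
  Monoid_isGroup.Build free_group free_mulVg free_mulgV.

Section UniversalProperty.
Variables (H : groupType) (e : X -> H).

Definition letter_val a : H := if a.2 then (e a.1)^-1 else e a.1.

Definition free_lift f : H := \prod_(a <- free_word f) letter_val a.

Lemma letter_valV a : letter_val (letter_inv a) = (letter_val a)^-1.
Proof. by case: a => x [] //=; rewrite /letter_val /= invgK. Qed.

Lemma free_liftM : {morph free_lift : f g / f * g}.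
Proof.
move=> f g; rewrite /free_lift /= /word_mul.
elim: (free_word f) => /= [|a u IHu]; first by rewrite big_nil mul1g.
rewrite big_cons -mulgA -IHu; case: (foldr _ _ u) => [|b w] /=.
  by rewrite big_seq1 big_nil mulg1.
case: eqP => [->|_]; last by rewrite !big_cons.
by rewrite big_cons letter_valV mulVKg.
Qed.

Lemma free_lift1 : free_lift 1 = 1.
Proof. by rewrite /free_lift big_nil. Qed.

HB.instance Definition _ :=
  isUMagmaMorphism.Build free_group H free_lift (free_lift1, free_liftM).

Lemma free_lift_gen x : free_lift (free_gen x) = e x.
Proof. by rewrite /free_lift big_seq1. Qed.

Lemma free_lift_unique (phi : UMagmaMorphism.type free_group H) :
  (forall x, phi (free_gen x) = e x) -> phi =1 free_lift.
Proof.
move=> phiE [w]; elim: w => [|a w IHw] rw.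
  rewrite (_ : FreeGroup rw = 1); last exact: val_inj.
  by rewrite gmulf1 free_lift1.
have rw' := reduced_behead rw.
pose fa : free_group := @FreeGroup [:: a] isT.
have -> : FreeGroup rw = fa * FreeGroup rw'.
  apply: val_inj => /=; case: w rw {IHw rw'} => //= b w /andP[].
  by rewrite /= => /negPf ->.
rewrite gmulfM free_liftM IHw; congr (_ * _); rewrite /free_lift big_seq1 /fa.
case: a {fa rw} => x [] /=; rewrite /letter_val /= -phiE; last first.
  by congr (phi _); apply: val_inj.
by rewrite -gmulfV; congr (phi _); apply: val_inj.
Qed.

End UniversalProperty.
End FreeGroup.

Section Subgroups.
Variable G : groupType.
Implicit Types (A B H : set G).

Definition is_subgroup H : Prop :=
  [/\ H 1, (forall x y, H x -> H y -> H (x * y)) & forall x, H x -> H x^-1].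

Definition is_normal H : Prop := forall x g, H x -> H (x ^ g).

Definition generated A : set G := smallest is_subgroup A.

Definition normal_closure A : set G :=
  smallest [set H | is_subgroup H /\ is_normal H] A.

Definition commutator_subgroup A B : set G :=
  generated [set [~ x, y] | x in A & y in B].

Definition power_subgroup (n : nat) A : set G :=
  generated [set x ^+ n | x in A].

Definition set_product A B : set G := [set x * y | x in A & y in B].

Definition left_cosets H : set (set G) :=
  [set [set g * x | x in H] | g in [set: G]].

Definition has_index H (n : nat) : Prop := left_cosets H #= `I_n.

End Subgroups.

Section Zassenhaus.
Variables (p : nat) (G : groupType).

Definition ceil_div (i d : nat) : nat := ((i + d.-1) %/ d)%N.

(* The first argument bounds the recursion depth; see zassenhausE. *)
Fixpoint zassenhaus_rec (n i : nat) : set G :=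
  if n is m.+1 then
    if (i <= 1)%N then setT
    else set_product
           (commutator_subgroup (zassenhaus_rec m i.-1) setT)
           (power_subgroup p (zassenhaus_rec m (ceil_div i p)))
  else setT.

Definition zassenhaus (i : nat) : set G := zassenhaus_rec i i.

Lemma ceil_div_lt i : (1 < p)%N -> (1 < i)%N -> (ceil_div i p < i)%N.
Proof.
move=> p1 i1; rewrite /ceil_div ltn_divLR ?(ltnW p1) //.
case: p p1 => [|[|q]] // _; case: i i1 => [|[|i]] // _.
rewrite /= mulnS !addSn !mulSn mulnS; lia.
Qed.

Lemma zassenhaus_rec_stable n m i :
  (1 < p)%N -> (i <= n)%N -> (i <= m)%N ->
  zassenhaus_rec n i = zassenhaus_rec m i.
Proof.
move=> p1; elim: n m i => [|n IHn] [|m] i //=.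
- by rewrite leqn0 => /eqP ->.
- by move=> _; rewrite leqn0 => /eqP ->.
move=> lein leim; case: leqP => // i1.
have lt_c := ceil_div_lt p1 i1.
have leP k : (i <= k.+1)%N -> (i.-1 <= k)%N /\ (ceil_div i p <= k)%N.
  by move=> leik; split; [case: (i) leik | rewrite -ltnS (leq_trans lt_c)].
have [n1 n2] := leP _ lein; have [m1 m2] := leP _ leim.
by rewrite (IHn m i.-1) // (IHn m (ceil_div i p)).
Qed.

Lemma zassenhaus1 : zassenhaus 1 = setT.
Proof. by []. Qed.

Lemma zassenhausE i : (1 < p)%N -> (2 <= i)%N ->
  zassenhaus i =
    set_product (commutator_subgroup (zassenhaus i.-1) setT)
                (power_subgroup p (zassenhaus (ceil_div i p))).
Proof.
move=> p1 i2; have lt_c := ceil_div_lt p1 i2.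
case: i i2 lt_c => [|i] // i2 lt_c.
rewrite {1}/zassenhaus /= leqNgt i2 /= /zassenhaus.
by rewrite (@zassenhaus_rec_stable i (ceil_div i.+1 p) (ceil_div i.+1 p)).
Qed.

End Zassenhaus.

Arguments zassenhaus p {G} i.

(* The greatest element of A, when it exists. *)
Definition nat_max (A : set nat) : nat :=
  xget 0%N [set k | A k /\ forall j, A j -> (j <= k)%N].

Section Presentations.
Variable p : nat.

Definition nu (G : groupType) (r : G) : nat :=
  nat_max [set k | exists w : G, w ^+ (p ^ k)%N = r].

Definition degree (G : groupType) (w : G) : nat :=
  nat_max [set i | (0 < i)%N /\ zassenhaus p i w].

Definition is_presentation (X : finType) (R : set (free_group X))
    (G : groupType) : Prop :=
  exists phi : UMagmaMorphism.type (free_group X) G,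
    (forall g, exists w, phi w = g) /\
    [set w | phi w = 1] = normal_closure R.

Local Open Scope ring_scope.

Variable K : realType.

(* The maxima defining nu and degree do not exist at the trivial word, which  *)
(* gets weight p^(-oo) = t^oo = 0: it may belong to R but never counts.       *)
Definition nu_weight (G : groupType) (r : G) : K :=
  if r == 1%g then 0 else p%:R ^- nu r.

Definition degree_weight (t : K) (G : groupType) (r : G) : K :=
  if r == 1%g then 0 else t ^+ degree r.

(* A divergent sum has value +oo, which makes the deficiency -oo.             *)
Definition deficiency (X : finType) (R : set (free_group X)) : \bar K :=
  ((#|X|%:R : K)%:E - \esum_(r in R) (nu_weight r)%:E)%E.

Definition golod_shafarevich_condition
    (X : finType) (R : set (free_group X)) : Prop :=
  exists t : K, 0 < t < 1 /\
    ((1 - #|X|%:R * t : K)%R%:E + \esum_(r in R) (degree_weight t r)%:E < 0)%E.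

Definition puchta (G : groupType) : Prop :=
  exists (X : finType) (R : set (free_group X)),
    is_presentation R G /\ (1 < deficiency R)%E.

Definition golod_shafarevich (G : groupType) : Prop :=
  exists (X : finType) (R : set (free_group X)),
    is_presentation R G /\ golod_shafarevich_condition R.

End Presentations.

Arguments deficiency p K {X} R.
Arguments golod_shafarevich_condition p K {X} R.

(* Main.v *)
Require Import Defs.
From HB Require Import structures.
From mathcomp Require Import all_boot all_order all_algebra.
From mathcomp Require Import boolp classical_sets reals.
From mathcomp Require Import all_fingroup cyclic finmap zify lra.
From mathcomp Require Import cardinality fsbigop ereal esum.

(** Counting a relator r with weight p^(-nu r), the quantity def_p - 1 is
    multiplied by at least [G : H] when one passes from G to a normal subgroup H
    of p-power index. Indeed, in the Reidemeister-Schreier presentation of H, a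
    relator r = w^(p^k) of G has one lift per vertex of the Schreier graph, but
    lifts along the same cycle of w are conjugate; if that cycle has length p^j,
    there are [G : H] / p^j lifts left, each of them a p^(k - j)-th power.

    A group with def_p > 1 has fewer relators with nu = 0 than generators, and
    the other relators die in F_p: it maps onto Z/p. Applying this to the normal
    subgroups of p-power index in turn, one gets such subgroups of arbitrarily
    large index, so that def_p > 2 may be assumed. Then t = 1/2 is a witness for
    the Golod-Shafarevich condition: deg r >= p^(nu r), hence
    t^(deg r) <= t p^(-nu r), and the sum is at most 1 - def_p / 2. *)

Set Implicit Arguments.
Unset Strict Implicit.
Unset Printing Implicit Defensive.

Import Order.TTheory GRing.Theory Num.Theory.
Local Open Scope classical_set_scope.

(** * Degrees and roots in free groups *)

Lemma free_group_ind (X : choiceType) (H : set (free_group X)) :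
  is_subgroup H -> (forall x, H (free_gen x)) -> forall w, H w.
Proof.
case=> H1 HM HV Hgen [w]; elim: w => [|[x b] w IHw] rw.
  by rewrite (_ : FreeGroup rw = 1%g) //; apply: val_inj.
have rw' := reduced_behead rw.
have -> : FreeGroup rw = (@FreeGroup X [:: (x, b)] isT * FreeGroup rw')%g.
  apply: val_inj => /=; case: w rw {IHw rw'} => //= c w /andP[].
  by move=> /negPf ->.
apply: HM => //; case: b rw => rw; last exact: Hgen.
rewrite (_ : FreeGroup _ = (free_gen x)^-1%g); first exact/HV.
exact: val_inj.
Qed.

Lemma ceil_div_gt0 (i p : nat) : (0 < p)%N -> (0 < i)%N -> (0 < ceil_div i p)%N.
Proof. by move=> p0 i0; rewrite /ceil_div divn_gt0 //; lia. Qed.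

Lemma leq_ceil_divM (i p : nat) : (0 < p)%N -> (i <= ceil_div i p * p)%N.
Proof.
move=> p0; rewrite /ceil_div.
have := divn_eq (i + p.-1) p; have := ltn_pmod (i + p.-1) p0; lia.
Qed.

(** Strong induction along the recursion: commutators come from level i - 1, and p-th powers come
    from the rounded-up quotient of i by p, which times p is at least i. *)
Lemma zassenhaus_ind (p : nat) (G : groupType) (D : nat -> set G) :
    (1 < p)%N -> (forall g, D 1 g) ->
    (forall i, (0 < i)%N -> is_subgroup (D i)) ->
    (forall i x, D i.+1 x -> D i x) ->
    (forall i x y, (0 < i)%N -> D i x -> D i.+1 [~ x, y]%g) ->
    (forall i x, (0 < i)%N -> D i x -> D (i * p)%N (x ^+ p)%g) ->
  forall i, (0 < i)%N -> zassenhaus p i `<=` D i.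
Proof.
move=> p1 D1 Dsub Dle DR DX; elim/ltn_ind=> i IHi i_gt0.
case: (leqP i 1) => [i_le1 g _|i_gt1].
  by rewrite (_ : i = 1) //; apply/eqP; rewrite eqn_leq i_le1.
have lt_c := ceil_div_lt p1 i_gt1.
have c_gt0 := ceil_div_gt0 (ltnW p1) i_gt0.
have Dmono j k x : (j <= k)%N -> D k x -> D j x.
  by move=> /subnKC <-; elim: (k - j)%N => [|d IHd];
    rewrite ?addn0 // addnS => /Dle.
have [_ DM _] := Dsub i i_gt0.
rewrite zassenhausE // => _ [x xR [y yX <-]]; apply: DM.
  apply: xR; split=> [|_ [u uZ [v _ <-]]]; first exact: Dsub.
  have i1_gt0 : (0 < i.-1)%N by rewrite -ltnS (ltn_predK i_gt1).
  rewrite -(ltn_predK i_gt1); apply: DR => //.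
  by apply: IHi uZ; rewrite ?(ltn_predK i_gt1).
apply: yX; split=> [|_ [u uZ <-]]; first exact: Dsub.
apply: (Dmono _ (ceil_div i p * p)%N); last by apply: DX => //; apply: IHi uZ.
exact/leq_ceil_divM/ltnW.
Qed.

Lemma zassenhaus_pow (p k : nat) (G : groupType) (g : G) :
  (1 < p)%N -> zassenhaus p (p ^ k) (g ^+ (p ^ k))%g.
Proof.
move=> p1; elim: k => [|k IHk]; first by rewrite expn0 zassenhaus1.
have p_gt1 : (1 < p ^ k.+1)%N by rewrite -(expn0 p) ltn_exp2l.
(* The commutator factor is taken trivial: the power factor suffices because the rounded-up quotient
   of p^(k+1) by p is p^k. *)
rewrite zassenhausE //; exists 1%g; first by move=> H [[]].
exists (g ^+ (p ^ k.+1))%g; last by rewrite mul1g.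
move=> H [_]; apply; exists (g ^+ (p ^ k))%g; last by rewrite -expgM -expnSr.
rewrite (_ : ceil_div _ _ = p ^ k)%N // /ceil_div expnSr divnMDl ?(ltnW p1) //.
by rewrite divn_small ?addn0 //; case: p p1 {IHk p_gt1}.
Qed.

Local Open Scope ring_scope.

(** * Triangular matrices filtered by superdiagonals *)

Section TriangularFiltration.
Variables (R : nzRingType) (n : nat).
Implicit Types A B : 'M[R]_n.+1.

(* The ideals of the ring of upper triangular matrices that are generated by  *)
(* the products of i strictly upper triangular matrices.                      *)
Definition upper (i : nat) A : Prop :=
  forall a b : 'I_n.+1, (b < a + i)%N -> A a b = 0.

Lemma upper0 i : upper i 0. Proof. by move=> a b _; rewrite mxE. Qed.

Lemma upper1 : upper 0 1.
Proof.
move=> a b; rewrite addn0 mxE => lt_ba.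
by rewrite -val_eqE gtn_eqF.
Qed.

Lemma upperD i A B : upper i A -> upper i B -> upper i (A + B).
Proof. by move=> uA uB a b lt_ba; rewrite mxE uA ?uB ?addr0. Qed.

Lemma upperN i A : upper i A -> upper i (- A).
Proof. by move=> uA a b lt_ba; rewrite mxE uA ?oppr0. Qed.

Lemma upperM i j A B : upper i A -> upper j B -> upper (i + j) (A * B).
Proof.
move=> uA uB a b lt_ba; rewrite mxE big1 // => c _.
case: (ltnP c (a + i)) => [/uA -> | le_c]; first by rewrite mul0r.
by rewrite (uB c b) ?mulr0 // (leq_trans lt_ba) // addnA leq_add2r.
Qed.

Lemma upperW i j A : (i <= j)%N -> upper j A -> upper i A.
Proof.
by move=> le_ij uA a b lt_ba; apply: uA; apply: leq_trans lt_ba _;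
  rewrite leq_add2l.
Qed.

Lemma upperX i k A : upper i A -> upper (i * k) (A ^+ k).
Proof.
move=> uA; elim: k => [|k IHk]; first by rewrite muln0; apply: upper1.
by rewrite exprS mulnS; apply: upperM.
Qed.

Lemma upper_eq0 A : upper n.+1 A -> A = 0.
Proof. by move=> uA; apply/matrixP=> a b; rewrite mxE uA // ltn_addl. Qed.

End TriangularFiltration.

Section TriangularUnits.
Variables (R : comUnitRingType) (n : nat).
Implicit Types A B : 'M[R]_n.+1.

(** A strictly triangular matrix is nilpotent, so 1 + A is inverted by a finite geometric series in
    - A, whose terms are all upper triangular. *)
Lemma upper_unit A : upper 1 A -> 1 + A \is a GRing.unit /\ upper 0 (1 + A)^-1.
Proof.
move=> uA; pose S := \sum_(k < n.+1) (- A) ^+ k.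
have uX k : upper k ((- A) ^+ k).
  by rewrite -[k in upper k]mul1n; apply/upperX/upperN.
have AS : (1 + A) * S = 1.
  have -> : 1 + A = - (- A - 1) by rewrite opprB opprK addrC.
  by rewrite mulNr -subrX1 (upper_eq0 (uX n.+1)) sub0r opprK.
have [U _] : 1 + A \is a GRing.unit /\ S \is a GRing.unit := mulmx1_unit AS.
split=> //; have -> : (1 + A)^-1 = S by apply: (mulrI U); rewrite AS divrr.
elim/big_ind: S {AS} => [|B C|k _]; [exact: upper0 | exact: upperD|].
exact: upperW (uX k).
Qed.

End TriangularUnits.

Lemma invr_divl (S : unitRingType) (x y : S) :
  x \is a GRing.unit -> y \is a GRing.unit -> (y^-1 * x)^-1 = x^-1 * y.
Proof. by move=> Ux Uy; rewrite invrM ?unitrV // invrK. Qed.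

(** For x = 1 + a and y = 1 + b only a b - b a survives, up to a unit; hence taking a commutator
    adds filtration levels. *)
Lemma subr1_commg (S : unitRingType) (x y : S) :
  x \is a GRing.unit -> y \is a GRing.unit ->
  x^-1 * (y^-1 * (x * y)) - 1 =
    x^-1 * y^-1 * ((x - 1) * (y - 1) - (y - 1) * (x - 1)).
Proof.
move=> Ux Uy; have E (a b : S) : (a - 1) * (b - 1) = a * b - (a + b - 1).
  by rewrite mulrBl mulrBr mulr1 mul1r -addrA -opprD addrA.
rewrite !E [y + x]addrC; move: (x + y - 1) => c.
rewrite opprB addrA subrK mulrBr -!mulrA; congr (_ - _).
by rewrite mulKr // mulVr.
Qed.

Lemma reduced_onth (X : choiceType) (w : seq (X * bool)) i a b :
  reduced w -> onth w i = Some a -> onth w i.+1 = Some b -> b != letter_inv a.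
Proof.
move=> /(sortedP a)/(_ i) rw wi wj.
move: rw; rewrite -onthTE wj.
by rewrite (@onth_nth _ a _ _ _ wi) (@onth_nth _ a _ _ _ wj); apply.
Qed.

Section FreeGroupRepresentation.
Variables (X : choiceType) (p : nat) (p_prime : prime p).
Variable (w : seq (X * bool)).
Hypothesis w_reduced : reduced w.

Let n := size w.

(* The matrix (1 + step a^-1)^-1 * (1 + step a) represents the letter a. As w *)
(* is reduced, reading its k-th letter moves the last nonzero entry of the    *)
(* first row, which is a 1, from column k to column k + 1; hence the degree   *)
(* of w is at most its length.                                                *)
Definition step (a : X * bool) : 'M['F_p]_n.+1 :=
  \matrix_(i, j) ((val j == i.+1) && (onth w i == Some a))%:R.

Lemma step_upper a : upper 1 (step a).
Proof.
by move=> i j; rewrite addn1 ltnS mxE => le_ji; rewrite ltn_eqF.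
Qed.

Lemma mul_step (v : 'rV['F_p]_n.+1) a (j : 'I_n.+1) :
  (v *m step a) 0 j =
    if (0 < j)%N && (onth w j.-1 == Some a) then v 0 (inord j.-1) else 0.
Proof.
rewrite mxE; case: posnP => [j0 | j_gt0] /=.
  by rewrite big1 // => i _; rewrite mxE /= j0 mulr0.
have lt_j1 : (j.-1 < n.+1)%N by rewrite (leq_ltn_trans (leq_pred j)).
rewrite (bigD1 (inord j.-1)) //= mxE /= inordK // prednK // eqxx /=.
rewrite big1 ?addr0 => [|i /eqP ne_ij]; first by case: ifP;
  rewrite ?mulr1 ?mulr0.
rewrite mxE; case: eqP => [ji|]; last by rewrite mulr0.
by case: ne_ij; apply: val_inj; rewrite /= inordK // ji.
Qed.

Definition letter_mx (a : X * bool) : 'M['F_p]_n.+1 :=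
  (1 + step (letter_inv a))^-1 * (1 + step a).

Lemma letter_mx_unit a : letter_mx a \is a GRing.unit.
Proof.
rewrite /letter_mx unitrMl ?unitrV; first exact: (upper_unit (step_upper _)).1.
exact: (upper_unit (step_upper _)).1.
Qed.

Lemma letter_mx_inv a : letter_mx (letter_inv a) = (letter_mx a)^-1.
Proof.
have [Ua _] := upper_unit (step_upper a).
have [Ub _] := upper_unit (step_upper (letter_inv a)).
by rewrite /letter_mx letter_invK (invr_divl Ua Ub).
Qed.

Lemma letter_mx_upper a : upper 1 (letter_mx a - 1).
Proof.
have [Ua Ia] := upper_unit (step_upper (letter_inv a)).
rewrite /letter_mx -[X in _ - X](mulVr Ua) -mulrBr opprD addrACA subrr add0r.
rewrite -[1%N]add0n; apply: upperM => //.
by apply: upperD; [|apply: upperN]; apply: step_upper.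
Qed.

Definition letter_unit (x : X) : {unit 'M['F_p]_n.+1} :=
  FinRing.unit _ (letter_mx_unit (x, false)).

Definition word_mx (g : free_group X) : 'M['F_p]_n.+1 :=
  val (free_lift letter_unit g).

Lemma word_mxE g : word_mx g = \prod_(a <- free_word g) letter_mx a.
Proof.
rewrite /word_mx /free_lift (big_morph _ (@FinRing.val_unitM _)
  (@FinRing.val_unit1 _)).
apply: eq_bigr => -[x []] _ //=.
by rewrite -[(x, true)]/(letter_inv (x, false)) letter_mx_inv.
Qed.

Lemma word_mxM g h : word_mx (g * h)%g = word_mx g * word_mx h.
Proof. by rewrite /word_mx gmulfM. Qed.

Lemma word_mxV g : word_mx g^-1%g = (word_mx g)^-1.
Proof. by rewrite /word_mx gmulfV. Qed.

Lemma word_mxX g k : word_mx (g ^+ k)%g = (word_mx g) ^+ k.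
Proof. by rewrite /word_mx gmulfXn FinRing.val_unitX. Qed.

Lemma word_mx1 : word_mx 1%g = 1.
Proof. by rewrite /word_mx gmulf1. Qed.

Lemma word_mx_unit g : word_mx g \is a GRing.unit.
Proof. exact: valP. Qed.

Lemma word_mx_invB g : upper 1 (word_mx g - 1) -> upper 0 (word_mx g)^-1.
Proof. by move=> /upper_unit[_]; rewrite addrC subrK. Qed.

Lemma word_mx_upper_subgroup i : (0 < i)%N ->
  is_subgroup [set g | upper i (word_mx g - 1)].
Proof.
move=> i_gt0; split=> /=[|g h ug uh|g ug]; first by rewrite word_mx1 subrr;
  apply: upper0.
  rewrite word_mxM (_ : _ - 1 =
    (word_mx g - 1) * (word_mx h - 1) + (word_mx g - 1) + (word_mx h - 1)).
    by do 2![apply: upperD => //]; apply: (upperW _ (upperM ug uh));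
      rewrite leq_addr.
  by rewrite mulrBr mulr1 subrK mulrBl mul1r addrA subrK.
rewrite word_mxV -[1](mulVr (word_mx_unit g)) -{1}[(word_mx g)^-1]mulr1 -mulrBr.
rewrite -[i]add0n; apply: upperM; first by apply: word_mx_invB;
  apply: upperW ug.
by rewrite -opprB; apply: upperN.
Qed.

Lemma word_mx_upper1 g : upper 1 (word_mx g - 1).
Proof.
apply: (free_group_ind (word_mx_upper_subgroup (ltnSn 0)) _ g) => x /=.
by rewrite word_mxE big_seq1; apply: letter_mx_upper.
Qed.

(** By [zassenhaus_ind]: commutators gain a level by [subr1_commg], and in characteristic p the
    Frobenius identity g^p - 1 = (g - 1)^p multiplies the level by p. *)
Lemma zassenhaus_upper i : (0 < i)%N ->
  zassenhaus p i `<=` [set g | upper i (word_mx g - 1)].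
Proof.
apply: (zassenhaus_ind (D := fun i => [set g | upper i (word_mx g - 1)])) =>
  //=.
- exact: prime_gt1.
- exact: word_mx_upper1.
- exact: word_mx_upper_subgroup.
- by move=> {}i g; apply: upperW.
- move=> {}i g h i_gt0 ug; have uh := word_mx_upper1 h.
  have ug1 := word_mx_upper1 g.
  set x := word_mx g in ug ug1 *; set y := word_mx h in uh *.
  have -> : word_mx [~ g, h]%g - 1 =
      x^-1 * y^-1 * ((x - 1) * (y - 1) - (y - 1) * (x - 1)).
    rewrite /commg /conjg !word_mxM !word_mxV -/x -/y.
    exact: (subr1_commg (word_mx_unit g) (word_mx_unit h)).
  rewrite -[i.+1]add0n; apply: upperM.
    by rewrite -[0%N]addn0; apply: upperM; apply: word_mx_invB.
  by rewrite -addn1; apply: upperD; [|apply: upperN; rewrite addnC];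
    apply: upperM.
move=> {}i g i_gt0 ug; rewrite word_mxX.
have pC : p \in [pchar 'M['F_p]_n.+1].
  by rewrite pchar_lalg; apply: pchar_Fp.
have -> : word_mx g ^+ p - 1 = (word_mx g - 1) ^+ p.
  have C : GRing.comm (word_mx g - 1) 1 by apply: commr1.
  have := pFrobenius_autD_comm pC C.
  by rewrite !pFrobenius_autE expr1n subrK => ->; rewrite addrK.
exact: upperX.
Qed.

Lemma row_word_prefix k (j : 'I_n.+1) : (k <= n)%N -> (k <= j)%N ->
  (delta_mx 0 0 *m \prod_(a <- take k w) letter_mx a : 'rV['F_p]_n.+1) 0 j
    = (k == j)%:R.
Proof.
elim: k j => [|k IHk] j; first by rewrite take0 big_nil mulmx1 mxE eqxx eq_sym.
move=> lt_kn lt_kj.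
have wk : exists a, onth w k = Some a.
  by move: lt_kn; rewrite -onthTE; case: (onth w k) => // a _; exists a.
case: wk => a wk; rewrite (take_nth a lt_kn) (@onth_nth _ a _ _ _ wk).
rewrite -cats1 big_cat big_seq1 /=.
rewrite /letter_mx [X in _ *m X]mulrA !mulmxA.
set v := _ *m _ in IHk *; have [Ub _] := upper_unit (step_upper (letter_inv a)).
set u := v *m _.
(* This equation determines [u] column by column, so the inverse matrix is never computed. *)
have uE : u + u *m step (letter_inv a) = v.
  rewrite -{1}[u]mulmx1 -mulmxDr /u -mulmxA.
  by rewrite (_ : _ *m _ = 1%:M) ?mulmx1 //; apply: mulVr.
have uv i : u 0 i + (u *m step (letter_inv a)) 0 i = v 0 i.
  by have := congr1 (fun z : 'rV_n.+1 => z 0 i) uE; rewrite [LHS]mxE.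
(* From column k on, [u] agrees with [v]: a correction in column i requires letter i - 1 of w to be
   a^-1. For i = k this letter would cancel with the next one, a; for i = k + 1 it is a itself;
   beyond that, column i - 1 of [u] is already 0. *)
have uk (i : 'I_n.+1) : (k <= i)%N -> u 0 i = (k == i)%:R.
  have [m] := ubnP (nat_of_ord i); elim: m i => // m IHm i lt_im le_ki.
  have := uv i; rewrite mul_step IHk ?(ltnW lt_kn) //.
  case: ifP => [/andP[i_gt0 /eqP wi]|_]; last by rewrite addr0.
  have lt_i1 : (i.-1 < n.+1)%N by rewrite (leq_ltn_trans (leq_pred i)).
  have lt_ki : (k < i)%N.
    rewrite ltn_neqAle le_ki andbT; apply/eqP=> ki.
    rewrite -(prednK i_gt0) in ki; rewrite ki in wk.
    by have := reduced_onth w_reduced wi wk; rewrite letter_invK eqxx.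
  rewrite (IHm (inord i.-1)) ?inordK //; try by rewrite -ltnS prednK.
  case: (k =P i.-1) => [ki|_]; last by rewrite addr0.
  move: wi; rewrite -ki wk => -[/(congr1 snd)] /=.
  by case: (a.2).
(* As j > k, column j of [u] is 0, and the entry can only come from column j - 1 through
   [step a]. *)
rewrite mulmxDr mulmx1 mxE mul_step uk ?(ltnW lt_kj) // ltn_eqF // add0r.
have j_gt0 : (0 < j)%N by apply: leq_ltn_trans lt_kj.
have lt_j1 : (j.-1 < n.+1)%N by rewrite (leq_ltn_trans (leq_pred j)).
have uj : u 0 (inord j.-1) = (k == j.-1)%:R.
  by rewrite uk inordK // -ltnS prednK.
rewrite j_gt0 /= uj.
have -> : (k.+1 == j) = (k == j.-1) by rewrite -[RHS]eqSS prednK.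
by case: (k =P j.-1) => [<-|_]; rewrite ?wk ?eqxx // if_same.
Qed.

(** By [row_word_prefix] for the whole word, the top right entry is 1; the identity matrix has 0
    there because the word is nonempty. *)
Lemma word_mx_neq1 g : free_word g = w -> w != [::] ->
  ~ upper n.+1 (word_mx g - 1).
Proof.
move=> gw w0 u1; have := @row_word_prefix n ord_max (leqnn n) (leqnn n).
rewrite eqxx take_size -gw -word_mxE.
have -> : word_mx g = 1 by apply/eqP; rewrite -subr_eq0; apply/eqP/upper_eq0.
rewrite mulmx1 mxE eqxx /= -val_eqE /= /n size_eq0 (negPf w0).
by move/eqP; rewrite eq_sym oner_eq0.
Qed.

End FreeGroupRepresentation.

(** Each g is tested in the representation built from its own reduced word. This bound is what makes
    the maxima defining [nu] and [degree] exist. *)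
Lemma zassenhaus_size (X : choiceType) (p : nat) (g : free_group X) i :
  prime p -> g != 1%g -> zassenhaus p i g -> (i <= size (free_word g))%N.
Proof.
move=> p_prime g1 gi; rewrite leqNgt; apply/negP=> lt_gi.
have i_gt0 : (0 < i)%N by apply: leq_ltn_trans lt_gi.
have g0 : free_word g != [::].
  by apply: contra g1 => /eqP g0; apply/eqP/val_inj.
have ug := @zassenhaus_upper _ _ p_prime (free_word g) i i_gt0 g gi.
exact: (@word_mx_neq1 _ p _ (free_wordP g) g (erefl _) g0 (upperW lt_gi ug)).
Qed.

Lemma nat_maxP (A : set nat) (b : nat) :
  A !=set0 -> (forall k, A k -> (k <= b)%N) ->
  A (nat_max A) /\ forall k, A k -> (k <= nat_max A)%N.
Proof.
move=> [k Ak] Ab; rewrite /nat_max; case: xgetP => [m _ []|noM] //.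
pose P := [pred j | `[< A j >]].
have exP : exists j, P j by exists k; apply/asboolP.
have ubP j : P j -> (j <= b)%N by move/asboolP/Ab.
case: (ex_maxnP exP ubP) => m /asboolP Am mM.
by case: (noM m); split=> // j Aj; apply/mM/asboolP.
Qed.

Section RootsAndDegrees.
Variables (X : choiceType) (p : nat) (p_prime : prime p).
Implicit Types (g w : free_group X).

Lemma root_size w k : (w ^+ (p ^ k))%g != 1%g ->
  (p ^ k <= size (free_word (w ^+ (p ^ k))%g))%N.
Proof.
move=> w1; apply: (zassenhaus_size p_prime w1).
by apply: zassenhaus_pow; apply: prime_gt1.
Qed.

Lemma nu_max g : g != 1%g ->
  (exists w, w ^+ (p ^ nu p g) = g)%g /\
  forall k w, (w ^+ (p ^ k) = g)%g -> (k <= nu p g)%N.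
Proof.
move=> g1; have [||nuP nu_max] :=
  @nat_maxP [set k | exists w, (w ^+ (p ^ k) = g)%g] (size (free_word g)).
- by exists 0%N, g.
- move=> k [w wg]; apply: leq_trans (ltnW (ltn_expl k (prime_gt1 p_prime))) _.
  by rewrite -wg; apply: root_size; rewrite wg.
by split=> // k w wg; apply: nu_max; exists w.
Qed.

Lemma leq_pow_nu_degree g : g != 1%g -> (p ^ nu p g <= degree p g)%N.
Proof.
move=> g1; have [[w wg] _] := nu_max g1.
have [||_] :=
  @nat_maxP [set i | (0 < i)%N /\ zassenhaus p i g] (size (free_word g)).
- by exists 1%N.
- by move=> k [_]; apply: zassenhaus_size.
apply; split; first by rewrite expn_gt0 prime_gt0.
by rewrite /= -[X in zassenhaus _ _ X]wg; apply/zassenhaus_pow/prime_gt1.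
Qed.

End RootsAndDegrees.

(** * Presentations of kernels *)

Local Open Scope group_scope.

Section WreathProduct.
Variables (A : groupType) (P : finGroupType).

(** The regular wreath product, used twice: with a free group as base it rewrites words along a
    Schreier graph, with a finite base it extends quotients of a kernel to the whole group. *)
Definition wreath : Type := ({ffun P -> A} * P)%type.

HB.instance Definition _ := Choice.on wreath.

Implicit Types u v : wreath.

Definition wreath_mul u v : wreath :=
  ([ffun s => u.1 s * v.1 (s * u.2)], u.2 * v.2).
Definition wreath_one : wreath := ([ffun=> 1], 1).
Definition wreath_inv u : wreath := ([ffun s => (u.1 (s * u.2^-1))^-1], u.2^-1).

Fact wreath_mulA : associative wreath_mul.
Proof.
move=> u v w; congr pair; last exact: mulgA.
by apply/ffunP=> s; rewrite !ffunE /= !mulgA.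
Qed.

Fact wreath_mul1g : left_id wreath_one wreath_mul.
Proof.
move=> [f a]; congr pair; last exact: mul1g.
by apply/ffunP=> s; rewrite !ffunE /= mul1g mulg1.
Qed.

Fact wreath_mulg1 : right_id wreath_one wreath_mul.
Proof.
move=> [f a]; congr pair; last exact: mulg1.
by apply/ffunP=> s; rewrite !ffunE /= mulg1.
Qed.

Fact wreath_mulVg : left_inverse wreath_one wreath_inv wreath_mul.
Proof.
move=> [f a]; congr pair; last exact: mulVg.
by apply/ffunP=> s; rewrite !ffunE /= mulVg.
Qed.

Fact wreath_mulgV : right_inverse wreath_one wreath_inv wreath_mul.
Proof.
move=> [f a]; congr pair; last exact: mulgV.
by apply/ffunP=> s; rewrite !ffunE /= mulgK mulgV.
Qed.

HB.instance Definition _ := hasMul.Build wreath wreath_mul.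
HB.instance Definition _ := Magma_isSemigroup.Build wreath wreath_mulA.
HB.instance Definition _ := hasOne.Build wreath wreath_one.
HB.instance Definition _ :=
  BaseUMagma_isUMagma.Build wreath wreath_mul1g wreath_mulg1.
HB.instance Definition _ := hasInv.Build wreath wreath_inv.
HB.instance Definition _ :=
  Monoid_isGroup.Build wreath wreath_mulVg wreath_mulgV.

End WreathProduct.

HB.instance Definition _ (A P : finGroupType) := Finite.on (wreath A P).

Lemma wreathM (A : groupType) (P : finGroupType) (u v : wreath A P) s :
  (u * v).1 s = u.1 s * v.1 (s * u.2).
Proof. by rewrite ffunE. Qed.

(* Rewriting a word of X along the Schreier graph of theta, starting at the   *)
(* vertex s; the letter (s, x) is the edge from s to s * theta x.             *)
Section Rewriting.
Variables (X : choiceType) (P : finGroupType).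
Variable theta : UMagmaMorphism.type (free_group X) P.

Definition rewriting_gen (x : X) : wreath (free_group (P * X)%type) P :=
  ([ffun s => free_gen (s, x)], theta (free_gen x)).

Definition rewriting (s : P) (w : free_group X) : free_group (P * X)%type :=
  (free_lift rewriting_gen w).1 s.

Lemma rewriting_snd w : (free_lift rewriting_gen w).2 = theta w.
Proof.
pose H := [set w | (free_lift rewriting_gen w).2 = theta w].
apply: (@free_group_ind _ H) => [|x]; last by rewrite /H /= free_lift_gen.
split=> [|u v|u]; rewrite /H /= ?gmulf1 ?gmulfM ?gmulfV //.
  by move=> <- <-.
by move=> <-.
Qed.

Lemma rewritingM s u v :
  rewriting s (u * v) = rewriting s u * rewriting (s * theta u) v.
Proof. by rewrite /rewriting gmulfM wreathM rewriting_snd. Qed.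

Lemma rewriting1 s : rewriting s 1 = 1.
Proof. by rewrite /rewriting gmulf1 ffunE. Qed.

Lemma rewriting_free_gen s x : rewriting s (free_gen x) = free_gen (s, x).
Proof. by rewrite /rewriting free_lift_gen ffunE. Qed.

Lemma rewritingV s u : rewriting s u^-1 = (rewriting (s * (theta u)^-1) u)^-1.
Proof.
apply/esym/mulg1_eq; rewrite -[X in rewriting X u^-1](mulgVK (theta u) s) .
by rewrite -rewritingM mulgV rewriting1.
Qed.

(** A word in the kernel is a closed path, so its powers run around the same loop. *)
Lemma rewritingX s u k : theta u = 1 ->
  rewriting s (u ^+ k) = rewriting s u ^+ k.
Proof.
move=> u1; elim: k => [|k IHk]; first exact: rewriting1.
by rewrite !expgS rewritingM u1 mulg1 IHk.
Qed.

Lemma rewritingJ s u g : theta u = 1 ->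
  rewriting s (u ^ g) =
    rewriting (s * (theta g)^-1) u ^ rewriting (s * (theta g)^-1) g.
Proof.
move=> u1; rewrite conjgE !rewritingM rewritingV gmulfV u1 mulg1.
by rewrite conjgE.
Qed.

End Rewriting.

Section MorphismKernel.
Variables (G H : groupType) (f : UMagmaMorphism.type G H).

Lemma morph_ker_subgroup : is_subgroup [set x | f x = 1].
Proof.
split=> [|x y|x] /=; rewrite ?gmulf1 ?gmulfM ?gmulfV //.
  by move=> -> ->; rewrite mulg1.
by move=> ->; rewrite invg1.
Qed.

Lemma morph_ker_normal : is_normal [set x | f x = 1].
Proof. by move=> x g /= fx; rewrite gmulfJ fx conj1g. Qed.

End MorphismKernel.

Section NormalClosure.
Variables (G : groupType) (A : set G).

Lemma normal_closure_subgroup : is_subgroup (normal_closure A).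
Proof.
split=> [H [[[]]]|x y Hx Hy H HA|x Hx H HA] //.
  by have [[[_ HM _] _] _] := HA; apply: HM; [apply: Hx | apply: Hy].
by have [[[_ _ HV] _] _] := HA; apply: HV; apply: Hx.
Qed.

Lemma normal_closure_normal : is_normal (normal_closure A).
Proof. by move=> x g Hx H HA; have [[_ HJ] _] := HA; apply: HJ; apply: Hx. Qed.

Lemma sub_normal_closure : A `<=` normal_closure A.
Proof. by move=> x Ax H [_]; apply. Qed.

Lemma normal_closure_min (H : set G) :
  is_subgroup H -> is_normal H -> A `<=` H -> normal_closure A `<=` H.
Proof. by move=> sH nH AH x; apply. Qed.

End NormalClosure.

Section Kernel.
Variables (G : groupType) (P : finGroupType) (theta : UMagmaMorphism.type G P).

Definition in_kernel : pred G := [pred g | theta g == 1].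

Record kernel : Type := Kernel { kernel_val : G;
  kernel_valP : in_kernel kernel_val }.

HB.instance Definition _ := [isSub for kernel_val].
HB.instance Definition _ := [Choice of kernel by <:].

Fact kernel_closed : group_closed in_kernel.
Proof.
split=> [|x y]; rewrite !inE /= ?gmulf1 // gmulfF => /eqP -> /eqP ->.
by rewrite mulgV.
Qed.

HB.instance Definition _ := SubChoice_isSubGroup.Build G in_kernel kernel
  kernel_closed.

Lemma kernel_normal : is_normal [set g | in_kernel g].
Proof.
by move=> x g; rewrite /in_kernel /= gmulfJ => /eqP ->; rewrite conj1g.
Qed.

(** The cosets are the fibres of [theta], numbered through [enum P]. *)
Lemma kernel_index : (forall a, exists g, theta g = a) ->
  has_index [set g | in_kernel g] #|P|.
Proof.
move=> theta_surj; rewrite /has_index.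
pose F i : set G := [set g | theta g = nth 1 (enum P) i].
have enumP a : (index a (enum P) < #|P|)%N by rewrite cardE index_mem mem_enum.
have nth_enum a : nth 1 (enum P) (index a (enum P)) = a.
  by apply: nth_index; rewrite mem_enum.
have cosetE g :
    [set g * x | x in [set h | in_kernel h]] = F (index (theta g) (enum P)).
  apply/seteqP; rewrite /F nth_enum; split=> [_ [x /eqP x1 <-] | h hg] /=.
    by rewrite gmulfM x1 mulg1.
  exists (g^-1 * h); last by rewrite mulVKg.
  by apply/eqP; rewrite gmulfM gmulfV hg mulVg.
have -> : left_cosets [set h | in_kernel h] = F @` `I_#|P|.
  apply/seteqP; split=> [_ [g _ <-]|_ [i lt_i <-]].
    by rewrite cosetE; exists (index (theta g) (enum P)) => //; apply: enumP.
  have [g gi] := theta_surj (nth 1 (enum P) i); exists g => //.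
  by rewrite cosetE /F nth_enum gi.
apply: inj_card_eq => i j /set_mem lt_i /set_mem lt_j eqF.
have [g gi] := theta_surj (nth 1 (enum P) i).
have : F j g by rewrite -eqF.
rewrite /F /= gi => /eqP; rewrite nth_uniq ?enum_uniq -?cardE //.
by move/eqP.
Qed.

End Kernel.

(** * Reidemeister-Schreier presentation of a kernel *)

Section KernelPresentation.
Variables (X : finType) (G : groupType) (P : finGroupType).
Variables (R : set (free_group X)).
Variables (phi : UMagmaMorphism.type (free_group X) G).
Hypothesis phi_surj : forall g, exists w, phi w = g.
Hypothesis ker_phi : [set w | phi w = 1] = normal_closure R.
Variable (thetaG : UMagmaMorphism.type G P).
Variable theta : UMagmaMorphism.type (free_group X) P.
Hypothesis thetaE : forall w, theta w = thetaG (phi w).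
Variable t : P -> free_group X.
Hypothesis tK : forall s, theta (t s) = s.

Local Notation rewr := (rewriting theta).

(** The Schreier generator of the edge y for the transversal [t]. *)
Definition kernel_gen (y : P * X) : free_group X :=
  t y.1 * free_gen y.2 * (t (y.1 * theta (free_gen y.2)))^-1.

Local Notation psi := (free_lift kernel_gen).

(** Along the path of w from s the transversal factors telescope; only those at the two ends
    remain. *)
Lemma kernel_gen_rewriting s w :
  psi (rewr s w) = t s * w * (t (s * theta w))^-1.
Proof.
pose H := [set w | forall s, psi (rewr s w) = t s * w * (t (s * theta w))^-1].
move: s; apply: (@free_group_ind _ H) => [|x s]; last first.
  by rewrite rewriting_free_gen free_lift_gen.
split=> [s|u v Hu Hv s|u Hu s].
- by rewrite rewriting1 !gmulf1 !mulg1 mulgV.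
- by rewrite rewritingM free_liftM Hu Hv [theta (_ * _)]gmulfM !mulgA mulgVK.
- by rewrite rewritingV gmulfV /= Hu [theta _^-1]gmulfV mulgVK !invgM invgK
  mulgA.
Qed.

Lemma theta_kernel_gen z : theta (psi z) = 1.
Proof.
apply: (@free_group_ind _ [set z | theta (psi z) = 1]) => [|[s x]].
  split=> [|u v|u]; rewrite /= ?gmulf1 ?gmulfM ?gmulfV //.
    by move=> -> ->; rewrite mulg1.
  by move=> ->; rewrite invg1.
rewrite /= free_lift_gen /kernel_gen /=.
by rewrite ![theta (_ * _)]gmulfM gmulfV !tK mulgV.
Qed.

(** As [psi] lands in the kernel of [theta], [rewr 1] after [psi] is a morphism. It sends the
    generator (s, x) to itself, up to rewritten transversal words on both sides, and these lie in
    M. *)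
Lemma rewriting_kernel_gen (M : set (free_group (P * X)%type)) z :
  is_subgroup M -> is_normal M -> (forall s, M (rewr 1 (t s))) ->
  M (z^-1 * rewr 1 (psi z)).
Proof.
move=> [M1 MM MV] MJ Mt.
have rewrM u v : rewr 1 (psi (u * v)) = rewr 1 (psi u) * rewr 1 (psi v).
  by rewrite gmulfM rewritingM theta_kernel_gen mulg1.
have rewrV u : rewr 1 (psi u^-1) = (rewr 1 (psi u))^-1.
  by rewrite gmulfV rewritingV theta_kernel_gen invg1 mulg1.
apply: (@free_group_ind _ [set z | M (z^-1 * rewr 1 (psi z))]) => /= [|[s x]].
  split=> /=[|u v Mu Mv|u Mu].
  - by rewrite gmulf1 rewriting1 mulg1 invg1.
  - rewrite rewrM (_ : _ * _ =
      (u^-1 * rewr 1 (psi u)) ^ v * (v^-1 * rewr 1 (psi v))).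
      by apply: MM => //; apply: MJ.
    by rewrite conjgE invgM !mulgA mulgK.
  - rewrite rewrV -invgM; apply: MV.
    rewrite (_ : _ * _ = (u^-1 * rewr 1 (psi u)) ^ (u^-1)); first exact: MJ.
    by rewrite conjgE invgK mulgA mulKVg.
rewrite free_lift_gen /kernel_gen /= !rewritingM tK mul1g rewritingV mul1g.
rewrite gmulfM !tK mulgV rewriting_free_gen.
rewrite [X in M X]mulgA -conjgE.
apply: MM; first exact: MJ.
exact/MV.
Qed.

Variable R' : set (free_group (P * X)%type).
Hypothesis R'1 : forall z, R' z -> phi (psi z) = 1.
Hypothesis R't : forall s, normal_closure R' (rewr 1 (t s)).
Hypothesis R'R : forall s r, R r -> normal_closure R' (rewr s r).

(** All base points are treated at once because conjugation moves the base point. *)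
Lemma rewriting_normal_closure w s :
  normal_closure R w -> normal_closure R' (rewr s w).
Proof.
have [M1 MM MV] := normal_closure_subgroup R'.
have MJ := @normal_closure_normal _ R'.
pose H := [set w | theta w = 1 /\ forall s, normal_closure R' (rewr s w)].
suff: normal_closure R `<=` H by move=> RH /RH[].
have thetaR r : R r -> theta r = 1.
  move=> Rr; have: normal_closure R r by apply: sub_normal_closure.
  by rewrite -ker_phi thetaE /= => ->; rewrite gmulf1.
apply: normal_closure_min => [|x g [x1 Hx]|r Rr]; last first.
- by split=> [|s']; [apply: thetaR | apply: R'R].
- by split=> [|s']; [rewrite gmulfJ x1 conj1g | rewrite rewritingJ //;
  apply: MJ].
split=> [|u v [u1 Hu] [v1 Hv]|u [u1 Hu]].
- by split=> [|s']; rewrite ?gmulf1 ?rewriting1.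
- by split=> [|s']; rewrite ?gmulfM ?u1 ?v1 ?mulg1 // rewritingM; apply: MM.
- by split=> [|s']; rewrite ?gmulfV ?u1 ?invg1 // rewritingV; apply: MV.
Qed.

Fact kernel_gen_in_kernel y : in_kernel thetaG (phi (kernel_gen y)).
Proof.
have := theta_kernel_gen (free_gen y); rewrite free_lift_gen thetaE => h.
exact/eqP.
Qed.

(** If z dies in the kernel, [psi z] is a consequence of R, so its rewriting is a consequence of R';
    and z equals this rewriting modulo R'. *)
Lemma kernel_presentation : is_presentation R' (kernel thetaG).
Proof.
pose chi := free_lift (fun y => Kernel (kernel_gen_in_kernel y)).
have chiE z : val (chi z) = phi (psi z).
  apply: (@free_group_ind _ [set z | val (chi z) = phi (psi z)]) => [|y] /=;
    last first.
    by rewrite /chi !free_lift_gen.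
  split=> [|u v Hu Hv|u Hu] /=.
  - by rewrite /chi free_lift1 free_lift1 gmulf1.
  - have -> : chi (u * v) = chi u * chi v by rewrite /chi free_liftM.
    by rewrite free_liftM gmulfM -Hu -Hv.
  - have -> : chi u^-1 = (chi u)^-1 by rewrite /chi gmulfV.
    by rewrite !gmulfV -Hu.
exists chi; split=> [[g gK]|].
  (* Since [t 1] may be nontrivial, [psi] sends [rewr 1 w] to a conjugate of w; the outer factors of
     the witness undo the conjugation. *)
  have [w wg] := phi_surj g;
  exists ((rewr 1 (t 1))^-1 * rewr 1 w * rewr 1 (t 1)).
  have w1 : theta w = 1 by rewrite thetaE wg; apply/eqP.
  have E1 : psi (rewr 1 (t 1)) = t 1.
    by rewrite kernel_gen_rewriting tK mul1g mulgK.
  have E2 : psi (rewr 1 w) = t 1 * w * (t 1)^-1.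
    by rewrite kernel_gen_rewriting w1 mul1g.
  apply: val_inj; rewrite chiE !free_liftM gmulfV /= E1 E2.
  by rewrite -!mulgA mulVg mulg1 mulKg.
apply/seteqP; split=> z /=.
  move/(congr1 val); rewrite chiE => z1.
  have Rz : normal_closure R (psi z) by rewrite -ker_phi.
  have [M1 MM MV] := normal_closure_subgroup R'.
  have MJ := @normal_closure_normal _ R'.
  have := rewriting_kernel_gen z (normal_closure_subgroup R') MJ R't.
  move=> /MV; rewrite invgM invgK => Mz.
  have := MM _ _ (rewriting_normal_closure 1 Rz) Mz.
  by rewrite mulVKg.
apply: normal_closure_min (morph_ker_subgroup chi) (@morph_ker_normal _ _ chi)
  _ _.
by move=> u R'u; apply: val_inj; rewrite chiE R'1.
Qed.

End KernelPresentation.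

(** * The deficiency of a kernel *)

Section EsumBounds.
Variable K : realType.
Local Open Scope ring_scope.
Local Open Scope ereal_scope.

Lemma sub_le_esum (T : choiceType) (A B : set T) (a : T -> \bar K) :
  A `<=` B -> \esum_(i in A) a i <= \esum_(i in B) a i.
Proof.
move=> AB; apply: ereal_sup_le => _ [F [finF FA] <-] /=.
by exists F => //; split=> // x /FA /AB.
Qed.

(** Choosing one preimage per value turns the left side into a sum over a subset of A. It is needed
    because different indices may produce the same relator. *)
Lemma le_esum_image (T T' : choiceType) (A : set T) (f : T -> T')
    (a : T' -> \bar K) :
  \esum_(j in f @` A) a j <= \esum_(i in A) a (f i).
Proof.
have [[i0 Ai0]|A0] := pselect (A !=set0); last first.
  have -> : A = set0 by apply/seteqP; split=> // x Ax; case: A0; exists x.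
  by rewrite image_set0 !esum_set0.
have pre j : exists i, (f @` A) j -> A i /\ f i = j.
  have [[i Ai fi]|nj] := pselect ((f @` A) j); first by exists i.
  by exists i0 => /nj.
have [g gP] := choice pre.
rewrite (eq_esum (fun j Aj => congr1 a (esym (gP j Aj).2))).
rewrite -(@esum_image _ _ _ (f @` A) g (a \o f)) =>
  [|j k /set_mem Aj /set_mem Ak gjk].
  by apply: sub_le_esum => _ [j Aj <-]; case: (gP j Aj).
by rewrite -(gP j Aj).2 -(gP k Ak).2 gjk.
Qed.

Lemma le_esumU (T : choiceType) (A B : set T) (a : T -> \bar K) :
  (forall i, 0 <= a i) ->
  \esum_(i in A `|` B) a i <= \esum_(i in A) a i + \esum_(i in B) a i.
Proof.
move=> a0; rewrite (esumID A) => [|i _]; last exact: a0.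
apply: leeD; apply: sub_le_esum => x /=; first by case.
by case=> -[].
Qed.

Lemma esum_finset (T : finType) (A : {set T}) (a : T -> \bar K) :
  (forall i, 0 <= a i) -> \esum_(i in [set` A]) a i = \sum_(i in A) a i.
Proof.
move=> a0; rewrite esum_fset => [||i _]; [|exact: finite_finset|exact: a0].
rewrite (_ : [set` A] = [set` enum A]); last by apply/seteqP; split=> x;
  rewrite /= mem_enum.
by rewrite -fsbig_seq ?enum_uniq // big_enum.
Qed.

End EsumBounds.

Section KernelRelators.
Variables (K : realType) (p : nat) (p_prime : prime p).
Variables (X : choiceType) (P : finGroupType).
Variable theta : UMagmaMorphism.type (free_group X) P.

Definition nu_root (r : free_group X) : free_group X :=
  xget 1 [set w | w ^+ (p ^ nu p r) = r].

Lemma nu_root_pow r : nu_root r ^+ (p ^ nu p r) = r.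
Proof.
rewrite /nu_root; case: xgetP => [w _ //|no].
(* At r = 1, where [nu] is only a default value, 1 is a root of any exponent. *)
have [r1|r1] := eqVneq r 1; first by case: (no 1); rewrite /= r1 expg1n.
by have [[w wr] _] := nu_max p_prime r1; case: (no w).
Qed.

(* Moving the base point s along the root of r conjugates [rewriting s r], so *)
(* one base point per coset of the cyclic group that the root generates is    *)
(* enough.                                                                    *)
Definition base_points (r : free_group X) : {set P} :=
  repr @: lcosets <[theta (nu_root r)]> (finset.setTfor P).

Lemma card_base_points r : (#|base_points r| * #[theta (nu_root r)] <= #|P|)%N.
Proof.
rewrite -[X in (_ <= X)%N]finset.cardsT mulnC.
rewrite -(Lagrange (finset.subsetT <[theta (nu_root r)]>)).
by rewrite leq_mul2l -card_lcosets leq_imset_card orbT.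
Qed.

Lemma base_point_cycle r s : exists2 s', s' \in base_points r &
  exists i, s = s' * theta (nu_root r) ^+ i.
Proof.
set C := <[theta (nu_root r)]>.
exists (repr (s *: C)).
  by apply/imset_f/lcosetsP; exists s; rewrite ?inE.
have : repr (s *: C) \in s *: C by apply: (mem_repr s); apply: lcoset_refl.
rewrite lcoset_sym => /lcosetP[_ /cycleP[i ->] si].
by exists i.
Qed.

Local Open Scope ring_scope.

Lemma nu_weight_ge0 (F : groupType) (r : F) : 0 <= nu_weight p K r :> K.
Proof.
by rewrite /nu_weight; case: eqP => // _; rewrite invr_ge0 exprn_ge0 ?ler0n.
Qed.

Lemma nu_weight_le1 (F : groupType) (r : F) : nu_weight p K r <= 1 :> K.
Proof.
rewrite /nu_weight; case: eqP => _; first exact: ler01.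
rewrite invf_le1 ?exprn_gt0 ?ltr0n ?prime_gt0 //.
by rewrite exprn_ege1 // ler1n prime_gt0.
Qed.

(** With w the root of r and k = [nu p r], the order of theta w divides p^k, hence is some p^j. Then
    w^(p^j) is a closed path, and the lift of r is the p^(k - j)-th power of its lift. *)
Lemma nu_weight_rewriting s r : theta r = 1%g ->
  nu_weight p K (rewriting theta s r) <=
    #[theta (nu_root r)]%g%:R * nu_weight p K r.
Proof.
move=> r1; rewrite {1}/nu_weight; case: eqP => [_|/eqP sr1].
  by rewrite mulr_ge0 ?nu_weight_ge0 ?ler0n.
rewrite /nu_weight ifN; last by apply: contra sr1 => /eqP ->;
  rewrite rewriting1.
set a := theta (nu_root r); have rE := nu_root_pow r; set k := nu p r in rE *.
have : (#[a]%g %| p ^ k)%N by rewrite order_dvdn -gmulfXn rE r1.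
move=> /(dvdn_pfactor _ _ p_prime)[j le_jk aj].
have aj1 : theta (nu_root r ^+ (p ^ j))%g = 1%g by rewrite gmulfXn -aj
  expg_order.
have sE : (rewriting theta s (nu_root r ^+ (p ^ j)) ^+ (p ^ (k - j)) =
  rewriting theta s r)%g.
  by rewrite -rewritingX // -expgM -expnD subnKC // rE.
have [_ /(_ _ _ sE) le_nu] := nu_max p_prime sr1.
have p_gt0 : 0 < p%:R :> K by rewrite ltr0n prime_gt0.
rewrite aj natrX -(subnK le_jk) exprD invfM mulrCA mulfV ?mulr1 ?gt_eqF
  ?exprn_gt0 //.
rewrite lef_pV2 ?posrE ?exprn_gt0 // ler_eXn2l ?ltr1n ?prime_gt1 //.
Qed.

End KernelRelators.

Local Open Scope ring_scope.

Section KernelDeficiency.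
Variables (K : realType) (p : nat) (p_prime : prime p).

Definition deficiency_gt (c : K) (G : groupType) : Prop :=
  exists (X : finType) (R : set (free_group X)),
    is_presentation R G /\ (c%:E < deficiency p K R)%E.

Lemma deficiency_gt_sum (c : K) (X : finType) (R : set (free_group X)) :
  (c%:E < deficiency p K R)%E ->
  exists2 sigma : K, (\esum_(r in R) (nu_weight p K r)%:E)%E = sigma%:E &
    c < #|X|%:R - sigma.
Proof.
rewrite /deficiency; have : (0 <= \esum_(r in R) (nu_weight p K r)%:E)%E.
  by apply: esum_ge0 => r _; rewrite lee_fin nu_weight_ge0.
case: (\esum_(r in R) _)%E => //= sigma _.
by rewrite -EFinB lte_fin => lt_c; exists sigma.
Qed.

Section Relators.
Variables (X : finType) (P : finGroupType) (R : set (free_group X)).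
Variable theta : UMagmaMorphism.type (free_group X) P.
Hypothesis thetaR : forall r, R r -> theta r = 1%g.
Variable t : P -> free_group X.

(** These play the part of a spanning tree of the Schreier graph; the vertex 1 is left out because
    [kernel_deficiency] takes [t 1] trivial. *)
Definition transversal_relators : set (free_group (P * X)%type) :=
  [set rewriting theta 1%g (t s) | s in [set~ 1%g]].

Definition lifted_relators : set (free_group (P * X)%type) :=
  [set rewriting theta rs.2 rs.1 |
    rs in R `*`` (fun r => [set` base_points p theta r])].

Lemma transversal_relators_weight :
  (\esum_(r in transversal_relators) (nu_weight p K r)%:E <=
   (#|P|%:R - 1)%:E)%E.
Proof.
apply: le_trans (le_esum_image _ _ _) _.
rewrite (_ : [set~ 1%g] = [set` [set~ 1%g : P]%SET]); last first.
  by apply/seteqP; split=> s /=; rewrite !inE; [move/eqP|move=> /eqP].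
rewrite esum_finset => [|s]; last by rewrite lee_fin nu_weight_ge0.
rewrite sumEFin lee_fin.
apply: (@le_trans _ _ (\sum_(s in [set~ 1%g : P]%SET) 1)).
  by apply: ler_sum => s _; apply: nu_weight_le1.
rewrite sumr_const cardsC1 -subn1 natrB //.
by apply/card_gt0P; exists 1%g.
Qed.

(** For each r, the order of theta at its root bounds the growth of the weight of a lift and divides
    the number of lifts; the two effects cancel, leaving at most |P| times the weight of r. *)
Lemma lifted_relators_weight :
  (\esum_(r in lifted_relators) (nu_weight p K r)%:E <=
   \sum_(s : P) \esum_(r in R) (nu_weight p K r)%:E)%E.
Proof.
apply: le_trans (le_esum_image _ _ _) _.
pose w r s := (nu_weight p K (rewriting theta s r))%:E.
have w0 r s : (0 <= w r s)%E by rewrite lee_fin nu_weight_ge0.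
rewrite -(@esum_esum _ _ _ R (fun r => [set` base_points p theta r]) w) //.
rewrite -(@esum_sum _ _ _ R (index_enum P) xpredT
  (fun r _ => (nu_weight p K r)%:E)); last first.
  by move=> r s _ _; rewrite lee_fin nu_weight_ge0.
apply: le_esum => r Rr; rewrite esum_finset // /w !sumEFin lee_fin.
set a := theta (nu_root p r).
apply: (@le_trans _ _
  (\sum_(s in base_points p theta r) #[a]%g%:R * nu_weight p K r)).
  by apply: ler_sum => s _; apply: nu_weight_rewriting => //; apply: thetaR.
rewrite !sumr_const -[leLHS]mulr_natl -[leRHS]mulr_natl mulrA -natrM.
rewrite ler_wpM2r ?nu_weight_ge0 // ler_nat.
exact: card_base_points.
Qed.

End Relators.

(** If sigma is the weight of R, the new deficiency minus 1 is at least |P| |X| - (|P| - 1) - |P|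
    sigma - 1 = |P| (|X| - sigma - 1). *)
Lemma kernel_deficiency (G : groupType) (P : finGroupType) (c : K)
    (theta : UMagmaMorphism.type G P) :
  (forall a, exists g, theta g = a) -> deficiency_gt (1 + c) G ->
  deficiency_gt (1 + #|P|%:R * c) (kernel theta).
Proof.
move=> theta_surj [X [R [[phi [phi_surj ker_phi]] def_gt]]].
have [sigma sumR lt_c] := deficiency_gt_sum def_gt.
have [thetaX thetaXE] : exists f : UMagmaMorphism.type (free_group X) P,
    forall w, f w = theta (phi w) by exists (theta \o phi).
have thetaR r : R r -> thetaX r = 1%g.
  move=> Rr; have: normal_closure R r by apply: sub_normal_closure.
  by rewrite -ker_phi thetaXE /= => ->; rewrite gmulf1.
have thetaX_surj s : exists w, thetaX w = s /\ (s = 1%g -> w = 1%g).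
  have [->|s1] := eqVneq s 1%g; first by exists 1%g; rewrite gmulf1.
  have [g gs] := theta_surj s; have [w wg] := phi_surj g.
  by exists w; split=> [|/eqP]; [rewrite thetaXE wg | rewrite (negPf s1)].
have [t tP] := choice thetaX_surj.
have tK s : thetaX (t s) = s by case: (tP s).
pose R' := transversal_relators thetaX t `|` lifted_relators R thetaX.
have MJ := @normal_closure_normal _ R'.
exists (P * X)%type, R'; split.
  apply: (@kernel_presentation _ _ _ R phi phi_surj ker_phi theta thetaX _ t tK
    R') => //.
  - move=> z [[s _ <-]|[[r s] [/= Rr _] <-]];
    rewrite /= kernel_gen_rewriting //.
      by rewrite tK mul1g (tP 1%g).2 // mul1g mulgV gmulf1.
    have /= r1 : (phi r = 1)%g.
      have: normal_closure R r by apply: sub_normal_closure.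
      by rewrite -ker_phi.
    by rewrite thetaR // mulg1 !gmulfM gmulfV r1 mulg1 mulgV.
  - move=> s; have [->|/eqP s1] := eqVneq s 1%g.
      rewrite (tP 1%g).2 // rewriting1.
      by case: (normal_closure_subgroup R').
    by apply: sub_normal_closure; left; exists s.
  (* Reading w^i r = r w^i from s' in two ways shows that the lift of r at s is conjugate to its
     lift at the base point s'. *)
  - move=> s r Rr; have [s' s'_base [i si]] := base_point_cycle p thetaX r s.
    set w := nu_root p r in si.
    have wr : commute (w ^+ i)%g r.
      by rewrite -(nu_root_pow p_prime r); apply: commuteX2.
    have r1 := thetaR r Rr.
    have R'r : normal_closure R' (rewriting thetaX s' r).
      by apply: sub_normal_closure; right; exists (r, s').
    have := MJ _ (rewriting thetaX s' (w ^+ i)%g) R'r.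
    have /(congr1 (rewriting thetaX s')) : (w ^+ i * r = r * w ^+ i)%g by [].
    rewrite !rewritingM r1 mulg1 gmulfXn -si => E.
    by rewrite conjgE -E mulKg.
rewrite /deficiency.
have sumR' : (\esum_(r in R') (nu_weight p K r)%:E <=
    (#|P|%:R - 1 + #|P|%:R * sigma)%:E)%E.
  apply: le_trans (le_esumU _ _ _) _ => [r|].
    by rewrite lee_fin nu_weight_ge0.
  rewrite EFinD leeD ?transversal_relators_weight //.
  apply: le_trans (lifted_relators_weight thetaR) _.
  by rewrite sumR sumEFin sumr_const lee_fin mulr_natl.
apply: (@lt_le_trans _ _
  (#|{: P * X}|%:R%:E - (#|P|%:R - 1 + #|P|%:R * sigma)%:E)%E); last first.
  by rewrite leeB.
rewrite -EFinB lte_fin card_prod natrM.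
have P0 : 0 < #|P|%:R :> K by rewrite ltr0n; apply/card_gt0P; exists 1%g.
have : #|P|%:R * c < #|P|%:R * (#|X|%:R - sigma - 1) by rewrite ltr_pM2l //;
  lra.
by lra.
Qed.

End KernelDeficiency.

(** * Large p-quotients *)

Lemma morph_exists (G H : groupType) (h : G -> H) :
    {morph h : x y / (x * y)%g} ->
  exists f : UMagmaMorphism.type G H, f =1 h.
Proof.
move=> hM; have h1 : h 1%g = 1%g by apply: (@mulgI _ (h 1%g));
  rewrite -hM !mulg1.
pose hI := isUMagmaMorphism.Build G H h (h1, hM).
by exists (HB.pack_for (UMagmaMorphism.type G H) h hI).
Qed.

Lemma morph_factor (F G H : groupType) (phi : UMagmaMorphism.type F G)
    (f : UMagmaMorphism.type F H) :
  (forall g, exists w, phi w = g) -> (forall w, phi w = 1%g -> f w = 1%g) ->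
  exists h : UMagmaMorphism.type G H, forall w, h (phi w) = f w.
Proof.
move=> phi_surj ker_sub; have [s sK] := choice phi_surj.
have fE u v : phi u = phi v -> f u = f v.
  move=> uv; apply: divg1_eq; rewrite -gmulfF; apply: ker_sub.
  by rewrite gmulfF uv divgg.
have [x y|h hE] := @morph_exists G H (fun g => f (s g)).
  by rewrite -gmulfM; apply: fE; rewrite gmulfM !sK.
by exists h => w; rewrite hE; apply: fE; rewrite sK.
Qed.

Section PrimeQuotient.
Variables (K : realType) (p : nat) (p_prime : prime p).

Lemma expg_Fp (a : 'F_p) : (a ^+ p = 1)%g.
Proof.
by have := expg_cardG (finset.in_setT a); rewrite finset.cardsT card_Fp.
Qed.

Section Exponents.
Variable X : finType.
Implicit Types (c : X -> 'F_p) (w : free_group X).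

(** The coordinates of w in the abelianization of the free group mod p. *)
Definition exponent w (x : X) : 'F_p :=
  \sum_(a <- free_word w | a.1 == x) (-1) ^+ a.2.

Lemma free_lift_Fp c w : free_lift c w = \sum_x c x * exponent w x :> 'F_p.
Proof.
transitivity (\sum_(a <- free_word w) (-1) ^+ a.2 * c a.1).
  (* As a finite group, 'F_p is its additive group. *)
  have FpM (a b : 'F_p) : (a * b)%g = a + b by [].
  have FpV (a : 'F_p) : (a^-1)%g = - a by [].
  rewrite /free_lift; elim: (free_word w) => [|[x b] u IHu];
    rewrite ?big_nil //.
  rewrite !big_cons IHu FpM /letter_val; congr (_ + _).
  by case: b; rewrite /= ?FpV ?mulN1r ?mul1r.
rewrite (partition_big (fun a : X * bool => a.1) xpredT) //=.
apply: eq_bigr => x _; rewrite mulr_sumr; apply: eq_bigr => a /eqP <-.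
by rewrite mulrC.
Qed.

(** A matrix with more rows than columns has a nonzero left kernel; a vector in it is the desired
    c. *)
Lemma killing_exponents (s : seq (free_group X)) : (size s < #|X|)%N ->
  exists2 c : X -> 'F_p, (exists x, c x != 0) &
    forall w, w \in s -> free_lift c w = 1%g.
Proof.
move=> lt_sX.
pose A := \matrix_(i < #|X|, j < size s) exponent (nth 1%g s j) (enum_val i).
have : kermx A != 0.
  rewrite -mxrank_eq0 mxrank_ker -lt0n subn_gt0.
  exact: leq_ltn_trans (rank_leq_col A) lt_sX.
case/rowV0Pn => v /sub_kermxP vA v0.
exists (fun x => v 0 (enum_rank x)).
  have /existsP[i vi] : [exists i, v 0 i != 0].
    apply: contraNT v0; rewrite negb_exists => /forallP v0.
    by apply/eqP/rowP => i; rewrite mxE; apply/eqP; have := v0 i; rewrite negbK.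
  by exists (enum_val i); rewrite enum_valK.
move=> w ws; rewrite free_lift_Fp.
have lt_w : (index w s < size s)%N by rewrite index_mem.
have := congr1 (fun B : 'rV_(size s) => B 0 (Ordinal lt_w)) vA.
rewrite !mxE => E; rewrite -[RHS]E.
rewrite (reindex (fun i : 'I_#|X| => enum_val i)) /=;
  last by exists enum_rank => ? _; rewrite ?enum_rankK ?enum_valK.
by apply: eq_bigr => i _; rewrite mxE enum_valK nth_index.
Qed.

End Exponents.

(** Each such relator has weight 1, so any finite set of them has at most sigma < |X| - 1
    elements. *)
Lemma prime_relators (X : finType) (R : set (free_group X)) :
  (1 < deficiency p K R)%E ->
  exists2 s : seq (free_group X), (size s < #|X|)%N &
    forall r, R r -> r != 1%g -> nu p r = 0 -> r \in s.
Proof.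
move=> /deficiency_gt_sum[sigma sumR lt_1].
pose R0 := [set r | [/\ R r, r != 1%g & nu p r = 0]].
have card_R0 (B : {fset free_group X}) : [set` B] `<=` R0 -> (#|` B| < #|X|)%N.
  move=> BR0; rewrite -(ltr_nat K).
  suff : #|` B|%:R <= sigma by lra.
  rewrite -lee_fin -sumR; apply: esum_ge; exists [set` B].
    by split=> // r /BR0[].
  rewrite -fsbig_seq ?fset_uniq // (eq_big_seq (fun=> 1%E)) => [|r rB].
    by rewrite sumEFin big_const_seq count_predT iter_addr addr0.
  by have [_ r1 nu0] := BR0 r rB; rewrite /nu_weight (negPf r1) nu0 expr0 invr1.
have finR0 : finite_set R0.
  apply: contrapT => /(@infinite_set_fset _ _ #|X|)[B BR0 cardB].
  by have := card_R0 B BR0; rewrite ltnNge cardB.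
exists (fset_set R0); first by apply: card_R0; rewrite fset_setK.
by move=> r Rr r1 nu0; rewrite in_fset_set // mem_set.
Qed.

Lemma deficiency_prime_quotient (G : groupType) : deficiency_gt p (1 : K) G ->
  exists (f : UMagmaMorphism.type G 'F_p) g, f g <> 1%g.
Proof.
move=> [X [R [[phi [phi_surj ker_phi]] def_gt]]].
have [s lt_s sP] := prime_relators def_gt.
have [c [x cx] cs] := killing_exponents lt_s.
have [f fE] : exists f : UMagmaMorphism.type G 'F_p,
    forall w, f (phi w) = free_lift c w.
  apply: morph_factor => // w w1.
  suff: normal_closure R `<=` [set w | free_lift c w = 1%g].
    by apply; rewrite -ker_phi.
  apply: normal_closure_min (@morph_ker_subgroup _ _ _) (@morph_ker_normal _ _
    _) _.
  move=> r Rr /=.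
  have [->|r1] := eqVneq r 1%g; first by rewrite free_lift1.
  have [nu0|nu_gt0] := posnP (nu p r); first by apply: cs; apply: sP.
  rewrite -(nu_root_pow p_prime r) -(prednK nu_gt0) expnSr expgM.
  by rewrite gmulfXn expg_Fp.
exists f, (phi (free_gen x)); rewrite fE free_lift_gen => cx1.
by rewrite cx1 eqxx in cx.
Qed.

End PrimeQuotient.

(** * Extending a quotient of a kernel to the whole group *)

Section InducedQuotient.
Variables (G : groupType) (P A : finGroupType).
Variables (theta : UMagmaMorphism.type G P).
Variable (f : UMagmaMorphism.type (kernel theta) A).
Variable sigma : P -> G.
Hypothesis sigmaK : forall s, theta (sigma s) = s.

Local Open Scope group_scope.

Fact induced_in_kernel g s :
  in_kernel theta (sigma s * g * (sigma (s * theta g))^-1).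
Proof. by rewrite /in_kernel /= !gmulfM gmulfV !sigmaK mulgV. Qed.

(* The Kaloujnine-Krasner embedding, followed by f in every coordinate. *)
Definition induced g : wreath A P :=
  ([ffun s => f (Kernel (induced_in_kernel g s))], theta g).

Lemma inducedM : {morph induced : g h / g * h}.
Proof.
move=> g h; congr pair; last by rewrite gmulfM.
apply/ffunP=> s; rewrite !ffunE /= -gmulfM; congr (f _); apply: val_inj => /=.
by rewrite gmulfM !mulgA mulgVK.
Qed.

(** Conjugation by [sigma 1] cancels the transversal factors in coordinate 1, which then equals f
    g. *)
Lemma induced_neq g : f g != 1 -> exists2 h, theta h = 1 &
  induced h <> induced 1.
Proof.
case: g => g g_ker fg; have g1 := eqP g_ker.
exists (g ^ sigma 1); first by rewrite gmulfJ g1 conj1g.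
move=> /(congr1 (fun u : wreath A P => u.1 1)); rewrite !ffunE => E.
case/eqP: fg; transitivity (f 1); last exact: gmulf1.
transitivity (f (Kernel (induced_in_kernel (g ^ sigma 1) 1))).
  congr (f _); apply: val_inj; rewrite /= gmulfJ g1 conj1g mulg1 conjgE.
  by rewrite !mulgA mulgV mul1g mulgK.
rewrite E; congr (f _); apply: val_inj.
by rewrite /= gmulf1 !mulg1 mulgV.
Qed.

Definition induced_image : {set wreath A P} :=
  [set u | `[< exists g, induced g = u >]]%SET.

Lemma mem_induced g : induced g \in induced_image.
Proof. by rewrite inE; apply/asboolP; exists g. Qed.

Lemma induced_imageP u : u \in induced_image -> exists g, induced g = u.
Proof. by rewrite inE => /asboolP. Qed.

Fact induced_image_group : group_set induced_image.
Proof.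
apply/group_setP; split=> [|u v /induced_imageP[g <-] /induced_imageP[h <-]].
  have -> : 1 = induced 1 by apply: (@mulgI _ (induced 1));
    rewrite -inducedM !mulg1.
  exact: mem_induced.
by rewrite -inducedM mem_induced.
Qed.

Canonical induced_group := Group induced_image_group.

(** The kernel of f need not be normal in G, so the quotient is the image of [induced]: a subgroup
    of a p-group, mapping onto P, and not injectively by [induced_neq]. *)
Lemma larger_quotient (p : nat) g : prime p ->
  (exists m, #|A| = p ^ m)%N -> (exists m, #|P| = p ^ m)%N -> f g != 1 ->
  exists (Q : finGroupType) (rho : UMagmaMorphism.type G Q),
    [/\ forall a, exists h, rho h = a, exists m, #|Q| = (p ^ m)%N &
      (#|P| < #|Q|)%N].
Proof.
move=> p_prime [a cardA] [b cardP] fg.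
have [rho rhoE] := @morph_exists G (subg_of induced_group)
  (subg induced_group \o induced)
  (fun x y => etrans (congr1 _ (inducedM x y))
    (subgM (mem_induced x) (mem_induced y))).
have cardQ : #|subg_of induced_group| = #|induced_image|.
  by rewrite card_sub; apply: eq_card.
exists (subg_of induced_group), rho; split.
- move=> u; have [h hu] := induced_imageP (valP u).
  by exists h; rewrite rhoE /= hu; apply: sgvalK.
- have : (#|induced_group| %| p ^ (a * #|P| + b))%N.
    have := cardSg (finset.subsetT induced_group).
    by rewrite finset.cardsT card_prod card_ffun cardA cardP -expnM -expnD.
  by rewrite cardQ => /(dvdn_pfactor _ _ p_prime)[m _ ->]; exists m.
rewrite cardQ.
have imP : [set u.2 | u in induced_image]%SET = finset.setTfor P.
  apply/setP=> s; rewrite inE; apply/imsetP; exists (induced (sigma s)).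
    exact: mem_induced.
  by rewrite /= sigmaK.
rewrite -[X in (X < _)%N]finset.cardsT -imP ltn_neqAle leq_imset_card andbT.
apply/negP=> /imset_injP inj2.
have [h h1] := induced_neq fg; apply.
apply: inj2; rewrite ?mem_induced //=.
by rewrite h1 gmulf1.
Qed.

End InducedQuotient.

Section LargeQuotients.
Variables (K : realType) (p : nat) (p_prime : prime p).

(** The deficiency of each kernel stays above 1, so the kernel maps onto Z/p and [larger_quotient]
    gives a quotient of G of larger order. *)
Lemma large_quotient (G : groupType) (c : K) n : 0 < c ->
  deficiency_gt p (1 + c) G ->
  exists (P : finGroupType) (theta : UMagmaMorphism.type G P),
    [/\ forall a, exists g, theta g = a, exists m, #|P| = (p ^ m)%N &
      (n < #|P|)%N].
Proof.
move=> c_gt0 defG; elim: n => [|n [P [theta [theta_surj P_pow lt_nP]]]].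
  have [theta thetaE] := @morph_exists G 'I_1 (fun=> 1%g) (fun _ _ =>
    esym (mulg1 _)).
  exists ('I_1 : finGroupType), theta; split=> [a||].
  - by exists 1%g; rewrite [a]ord1 gmulf1.
  - by exists 0%N; rewrite card_ord.
  - by rewrite card_ord.
have P0 : 0 < #|P|%:R :> K by rewrite ltr0n (leq_ltn_trans _ lt_nP).
have [X [R [presX defX]]] := kernel_deficiency p_prime theta_surj defG.
have def1 : deficiency_gt p (1 : K) (kernel theta).
  exists X, R; split=> //; apply: le_lt_trans defX.
  by rewrite lee_fin lerDl mulr_ge0 // ltW.
have [f [g /eqP fg]] := deficiency_prime_quotient p_prime def1.
have [sigma sigmaK] := choice theta_surj.
have [|Q [rho [rho_surj Q_pow lt_PQ]]] :=
  larger_quotient sigmaK p_prime _ P_pow fg.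
  by exists 1%N; rewrite card_Fp.
by exists Q, rho; split=> //; apply: leq_ltn_trans lt_PQ.
Qed.

(** * The witness t = 1/2 and the conclusion *)

Lemma half_pow_le k : (2^-1 : K) ^+ (p ^ k) <= 2^-1 * p%:R ^- k.
Proof.
have le_pk : (p ^ k <= 2 ^ (p ^ k).-1)%N.
  case: (p ^ k)%N => // m; exact: ltn_expl.
have p_gt0 : (0 < p ^ k)%N by rewrite expn_gt0 prime_gt0.
rewrite -(prednK p_gt0) exprS ler_pM2l ?invr_gt0 //.
rewrite exprVn -!natrX lef_pV2 ?posrE ?ltr0n ?expn_gt0 ?prime_gt0 //.
by rewrite ler_nat.
Qed.

Lemma degree_weight_half (X : choiceType) (r : free_group X) :
  degree_weight p (2^-1 : K) r <= 2^-1 * nu_weight p K r.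
Proof.
rewrite /degree_weight /nu_weight; case: eqP => [_|/eqP r1];
  first by rewrite mulr0.
apply: le_trans (half_pow_le _).
by rewrite ler_wiXn2l ?invr_ge0 ?invf_le1 ?ler1n ?leq_pow_nu_degree.
Qed.

Lemma deficiency_golod_shafarevich (G : groupType) :
  deficiency_gt p (2 : K) G -> golod_shafarevich p K G.
Proof.
move=> [X [R [presR /deficiency_gt_sum[sigma sumR lt_2]]]].
exists X, R; split=> //; exists 2^-1; split; first by lra.
have le_w : (\esum_(r in R) (degree_weight p 2^-1 r)%:E <= (2^-1 * sigma)%:E)%E.
  have w0 (r : free_group X) : (0 <= (degree_weight p (2^-1 : K) r)%:E)%E.
    by rewrite lee_fin /degree_weight; case: eqP => // _;
      rewrite exprn_ge0 ?invr_ge0.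
  (* The factor 1/2 is handled by doubling the terms, so that additivity of the sum is enough. *)
  have : (\esum_(r in R) ((degree_weight p (2^-1 : K) r)%:E +
      (degree_weight p (2^-1 : K) r)%:E) <= sigma%:E)%E.
    rewrite -sumR; apply: le_esum => r _; rewrite -EFinD lee_fin.
    by have := degree_weight_half r; lra.
  rewrite esumD //; have := esum_ge0 (fun r (_ : R r) => w0 r).
  case: (\esum_(r in R) _)%E => //= d _.
  by rewrite -EFinD !lee_fin; lra.
apply: (@le_lt_trans _ _ ((1 - #|X|%:R * 2^-1)%:E + (2^-1 * sigma)%:E)%E).
  by rewrite leeD2l.
by rewrite -EFinD lte_fin; lra.
Qed.

End LargeQuotients.

Local Open Scope classical_set_scope.

Theorem theorem5p3 (K : realType) (p : nat) (p_prime : prime p)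
    (G : groupType) (G_puchta : puchta p K G) :
  exists (S : pred G) (H : subGroupType S),
    [/\ golod_shafarevich p K H,
        is_normal [set x | S x] &
        exists k : nat, has_index [set x | S x] (p ^ k)%N].
Proof.
have [X [R [presR def1]]] := G_puchta.
have [sigma sumR lt_1] := deficiency_gt_sum def1.
(* Half of the excess over 1, so that the deficiency is strictly above 1 + c. *)
pose c : K := (#|X|%:R - sigma - 1) / 2%:R.
have c_gt0 : 0 < c by rewrite /c; lra.
have defG : deficiency_gt p (1 + c) G.
  exists X, R; split=> //; rewrite /deficiency sumR -EFinB lte_fin /c; lra.
(* Then |P| > n forces |P| c >= 1, which brings the deficiency of the kernel above 2. *)
pose n := Num.truncn c^-1.
have [P [theta [theta_surj [m cardP] lt_nP]]] :=
  large_quotient p_prime n c_gt0 defG.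
exists (in_kernel theta), (kernel theta); split.
- apply: (deficiency_golod_shafarevich p_prime).
  have [Y [R' [presR' defY]]] := kernel_deficiency p_prime theta_surj defG.
  exists Y, R'; split=> //; apply: le_lt_trans defY; rewrite lee_fin.
  suff : 1 <= #|P|%:R * c by lra.
  rewrite -ler_pdivrMr // div1r; apply/ltW/(lt_le_trans (truncnS_gt _)).
  by rewrite ler_nat.
- exact: kernel_normal.
- by exists m; rewrite -cardP; apply: kernel_index.
Qed.
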